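(* Let $k\ge 3$ and let $G$ be a $k$-connected equimatchable factor-critical graph with at least $2k+3$ vertices and a vertex cut $S$ of size $k$ such that $G-S$ has two components with at least $3$ vertices each. Then $G-S$ has exactly two components and both are complete graphs.
   Context: All graphs are finite, simple and undirected; subgraphs are induced. A graph is equimatchable if every maximal matching is a maximum matching. A graph is factor-critical if $G-v$ has a perfect matching for every vertex $v$. *)

(* Defs.v *)
From mathcomp Require Import all_boot.

Set Implicit Arguments.
Unset Strict Implicit.
Unset Printing Implicit Defensive.

(* A finite simple graph is a symmetric irreflexive relation [e] on a [finType];
   the subgraph induced by [A] is [induced e A] together with the vertex set
   [A] (vertices outside [A] remain in the type, as isolated points). *)

Section Graph.

Variables (T : finType) (e : rel T).

Definition induced (A : {set T}) : rel T :=
  [rel x y | [&& x \in A, y \in A & e x y]].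

Definition components (A : {set T}) : {set {set T}} :=
  equivalence_partition (connect (induced A)) A.

Definition connected (A : {set T}) : bool := #|components A| == 1.

Definition complete (A : {set T}) : Prop :=
  {in A &, forall x y, x != y -> e x y}.

Definition k_connected (k : nat) : Prop :=
  k < #|T| /\ forall X : {set T}, #|X| < k -> connected (~: X).

Definition vertex_cut (S : {set T}) : bool := 1 < #|components (~: S)|.

Definition edges : {set {set T}} := [set [set x; y] | x in T, y in T & e x y].

Definition matching (M : {set {set T}}) : bool :=
  (M \subset edges) && trivIset M.

Definition maximal_matching (M : {set {set T}}) : bool := maxset matching M.

Definition maximum_matching (M : {set {set T}}) : Prop :=
  matching M /\ forall N : {set {set T}}, matching N -> #|N| <= #|M|.

Definition equimatchable : Prop :=
  forall M : {set {set T}}, maximal_matching M -> maximum_matching M.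

End Graph.

Definition has_perfect_matching (T : finType) (e : rel T) (A : {set T}) : Prop :=
  exists2 M : {set {set T}}, matching (induced e A) M & cover M = A.

Definition factor_critical (T : finType) (e : rel T) : Prop :=
  forall v : T, has_perfect_matching e (~: [set v]).

(* Main.v *)
(* If [U] contains [S] and is covered by a matching, then, since every maximal
   matching of [G] misses a single vertex, at most one component has an odd rest
   outside [U], and an even rest has the property that each of its matchings
   extends to a perfect one.  The matchings of [S] into [G - S] are supplied by
   Hall's theorem, whose condition is a consequence of [k]-connectedness.
   A component [C] with at most [k] vertices is complete because some such
   matching avoids exactly the two given vertices of [C].  If [C] is larger, match
   [S] into [C] by [f]; moving up to three vertices of [S] to another component
   shows that the rest [L] of [C] together with a few vertices of [f(S)] is
   randomly matchable, and varying these vertices forces [C] to be a clique.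
   With three components two odd rests arise: if two of them are small, by
   covering all but one vertex of each, and otherwise by moving the partners of
   one or two vertices of [S] between components. *)
Require Import Defs.
From mathcomp Require Import all_boot.
From mathcomp Require Import zify.

Set Implicit Arguments.
Unset Strict Implicit.
Unset Printing Implicit Defensive.

(** * Neighbourhoods in a bipartite relation and Hall's theorem *)

Definition nbr (I J : finType) (r : I -> J -> bool) (A : {set I}) : {set J} :=
  [set j | [exists i in A, r i j]].

Section Hall.

Variables (I J : finType).
Implicit Types (r : I -> J -> bool) (A X : {set I}) (B : {set J}).

Lemma nbrP r A j : reflect (exists2 i, i \in A & r i j) (j \in nbr r A).
Proof. by rewrite inE; apply: exists_inP. Qed.

Lemma nbrU r A A' : nbr r (A :|: A') = nbr r A :|: nbr r A'.
Proof.
apply/setP => j; rewrite in_setU; apply/nbrP/orP => [[i]|].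
  by rewrite inE => /orP[] iA rij; [left|right]; apply/nbrP; exists i.
by case=> /nbrP[i iA rij]; exists i => //; rewrite inE iA ?orbT.
Qed.

(** Halmos-Vaughan induction on [#|X|]: a tight nonempty proper subset splits the problem into two
    independent ones; without such a subset there is always a spare neighbour, so one vertex may be
    matched arbitrarily. *)
Lemma hall (j0 : J) r X :
    (forall A, A \subset X -> #|A| <= #|nbr r A|) ->
  exists f : I -> J, {in X &, injective f} /\ {in X, forall i, r i (f i)}.
Proof.
have [m] := ubnP #|X|; elim: m r X => // m IH r X; rewrite ltnS => leXm hX.
have [->|[x xX]] := set_0Vmem X.
  (* For empty [X] a total function is still required, hence the default [j0]. *)
  by exists (fun _ => j0); split=> i; rewrite inE.
have [[A /and3P[AX A0 /eqP tA]]|nt] :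
    (exists A : {set I}, [&& A \proper X, A != set0 & #|A| == #|nbr r A|]) \/
    ~ (exists A : {set I}, [&& A \proper X, A != set0 & #|A| == #|nbr r A|]).
- case: (boolP [exists A : {set I}, [&& A \proper X, A != set0 & #|A| == #|nbr r A|]]).
    by move/existsP; left.
  by move/existsP; right.
- have [f [finj fr]] : exists f : I -> J,
      {in A &, injective f} /\ {in A, forall i, r i (f i)}.
    apply: IH; first by have := proper_card AX; lia.
    by move=> A' /subset_trans; move/(_ _ (proper_sub AX)); apply: hX.
  pose r' i j := r i j && (j \notin nbr r A).
  have [g [ginj gr]] : exists g : I -> J,
      {in X :\: A &, injective g} /\ {in X :\: A, forall i, r' i (g i)}.
    apply: IH.
      rewrite cardsD (setIidPr (proper_sub AX)).
      have := proper_card AX; rewrite -card_gt0 in A0; lia.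
    (* Hall's condition for [A'] outside [nbr r A] is the condition for [A :|: A'] after cancelling
       the tight set [A]. *)
    move=> A' /subsetP A'X.
    have /hX : A :|: A' \subset X.
      rewrite subUset proper_sub //=; apply/subsetP => i /A'X.
      by rewrite inE => /andP[].
    have dis : A :&: A' = set0.
      apply/setP => i; rewrite !inE; apply/negP => /andP[iA /A'X].
      by rewrite inE iA.
    rewrite cardsU dis cards0 subn0 nbrU tA.
    have -> : nbr r A :|: nbr r A' = nbr r A :|: nbr r' A'.
      apply/setP => j; rewrite !in_setU; case: (boolP (j \in nbr r A)) => //= jA.
      apply/nbrP/nbrP => -[i iA' rij]; exists i => //; first by rewrite /r' rij.
      by case/andP: rij.
    by rewrite cardsU; lia.
  exists (fun i => if i \in A then f i else g i); split=> [i i' iX i'X|i iX].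
    have gA i1 : i1 \in X -> i1 \notin A -> g i1 \notin nbr r A.
      by move=> h1 h2; have /gr/andP[] : i1 \in X :\: A by rewrite inE h2.
    have fA i1 : i1 \in A -> f i1 \in nbr r A.
      by move=> h1; apply/nbrP; exists i1 => //; apply: fr.
    case: ifP => [iA|/negbT iA]; case: ifP => [i'A|/negbT i'A].
    + exact: finj.
    + by move=> E; have := gA _ i'X i'A; rewrite -E fA.
    + by move=> E; have := gA _ iX iA; rewrite E fA.
    + by apply: ginj; rewrite inE ?iA ?i'A.
  case: ifP => [|/negbT] iA; first exact: fr.
  by have /gr/andP[] : i \in X :\: A by rewrite inE iA.
have [j rxj] : exists j, r x j.
  have := hX [set x]; rewrite sub1set => /(_ xX); rewrite cards1 card_gt0.
  by case/set0Pn => j /nbrP[i /set1P -> ?]; exists j.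
pose r' i j' := r i j' && (j' != j).
have [g [ginj gr]] : exists g : I -> J,
    {in X :\ x &, injective g} /\ {in X :\ x, forall i, r' i (g i)}.
  apply: IH; first by have := cardsD1 x X; rewrite xX; lia.
  move=> A AX; have [->|A0] := eqVneq A set0; first by rewrite cards0.
  have AX' : A \proper X by apply: sub_proper_trans AX (properD1 xX).
  (* No tight set is left, so deleting the single vertex [j] preserves Hall's condition. *)
  have ltA : #|A| < #|nbr r A|.
    rewrite ltn_neqAle hX ?proper_sub // andbT; apply/negP => tA.
    by apply: nt; exists A; rewrite AX' A0 tA.
  have -> : nbr r' A = nbr r A :\ j.
    apply/setP => j'; rewrite in_setD1; apply/nbrP/andP.
      by case=> i iA /andP[rij nj]; split=> //; apply/nbrP; exists i.
    by case=> nj /nbrP[i iA rij]; exists i => //; rewrite /r' rij.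
  by have := cardsD1 j (nbr r A); case: (j \in _); lia.
exists (fun i => if i == x then j else g i); split=> [i i' iX i'X|i iX].
  have gj i1 : i1 \in X -> i1 != x -> g i1 != j.
    by move=> h1 h2; have /gr/andP[] : i1 \in X :\ x by rewrite !inE h2.
  case: eqVneq => [->|ix]; case: eqVneq => [->|i'x] // E.
  + by have := gj _ i'X i'x; rewrite -E eqxx.
  + by have := gj _ iX ix; rewrite E eqxx.
  + by apply: ginj => //; rewrite !inE ?ix ?i'x.
case: eqVneq => [->|ix] //.
by have /gr/andP[] : i \in X :\ x by rewrite !inE ix.
Qed.

End Hall.

(* Mendelsohn-Dulmage: the vertices of [W] are matched bijectively with [X] and
   [#|W| - #|X|] dummies, where the vertices of [Y] may not use a dummy. *)
Lemma mendelsohn_dulmage (T : finType) (e : rel T) (X W Y : {set T}) :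
    Y \subset W ->
    (forall A : {set T}, A \subset X -> #|A| <= #|nbr e A :&: W|) ->
    (forall A : {set T}, A \subset Y -> #|A| <= #|nbr (fun y x => e x y) A :&: X|) ->
  exists f : T -> T, [/\ {in X &, injective f},
    {in X, forall x, e x (f x) /\ f x \in W} & Y \subset f @: X].
Proof.
move=> YW hX hY.
have [X0|[x0 x0X]] := set_0Vmem X.
  exists id; split=> [x x'|x|]; rewrite ?X0 ?inE //.
  have := hY Y (subxx _); rewrite X0 setI0 cards0 leqn0 cards_eq0 => /eqP ->.
  exact: sub0set.
pose N (A : {set T}) := nbr (fun y x => e x y) A :&: X.
have XW : #|X| <= #|W|.
  by apply: leq_trans (hX X (subxx _)) (subset_leq_card (subsetIr _ _)).
pose d := #|W| - #|X|.
pose r (w : T) (j : T + 'I_d) :=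
  match j with inl x => e x w && (x \in X) | inr _ => w \notin Y end.
have [|f [finj fr]] := @hall _ _ (inl x0 : T + 'I_d) r W.
  move=> A AW.
  have NA : inl @: N A \subset nbr r A.
    apply/subsetP => _ /imsetP[x /setIP[/nbrP[w wA ewx] xX] ->].
    by apply/nbrP; exists w => //=; rewrite ewx.
  have inlI : injective (@inl T 'I_d) by move=> a b [].
  have inrI : injective (@inr T 'I_d) by move=> a b [].
  (* If [A] leaves [Y], all [d] dummies are available to it, and [#|A| <= #|N A| + d] remains to be
     shown. *)
  case: (boolP (A \subset Y)) => [AY|/subsetPn[w wA wY]].
    by apply: leq_trans (hY _ AY) _; rewrite -(card_imset _ inlI) subset_leq_card.
  have : inl @: N A :|: inr @: [set: 'I_d] \subset nbr r A.
    rewrite subUset NA; apply/subsetP => _ /imsetP[i _ ->].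
    by apply/nbrP; exists w.
  move/subset_leq_card; apply: leq_trans; rewrite cardsU.
  have -> : inl @: N A :&: inr @: [set: 'I_d] = set0.
    by apply/setP => j; rewrite !inE; apply/negP => /andP[/imsetP[? _ ->] /imsetP[]].
  rewrite cards0 subn0 !card_imset // cardsT card_ord.
  (* A vertex of [X] outside [N A] has no neighbour in [A], so [hX] yields
     [#|X| - #|N A| <= #|W| - #|A|]. *)
  have /hX hB : X :\: N A \subset X by apply: subsetDl.
  have sB : nbr e (X :\: N A) :&: W \subset W :\: A.
    apply/subsetP => w' /setIP[/nbrP[x /setDP[xX xN] exw] w'W].
    rewrite inE w'W andbT; apply: contra xN => w'A.
    by rewrite inE xX andbT; apply/nbrP; exists w'.
  have := leq_trans hB (subset_leq_card sB).
  rewrite !cardsD (setIidPr AW) (setIidPr (subsetIr _ _)).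
  have := subset_leq_card AW; have := subset_leq_card (subsetIr _ _ : N A \subset X).
  by rewrite /N /d; lia.
(* There are exactly [#|W|] admissible values, so the injective [f] hits them all and can be
   inverted on [X]. *)
have fim : f @: W = [set j | match j with inl x => x \in X | inr _ => true end].
  apply/eqP; rewrite eqEcard; apply/andP; split.
    apply/subsetP => _ /imsetP[w /fr rw ->]; rewrite inE.
    by move: rw; rewrite /r; case: (f w) => // x /andP[].
  rewrite card_in_imset //.
  have -> : [set j | match j with inl x => x \in X | inr _ => true end] =
      inl @: X :|: inr @: [set: 'I_d].
    apply/setP => -[x|i]; rewrite !inE.
      rewrite mem_imset; last by move=> a b [].
      by apply/esym/orb_idr => /imsetP[].
    by apply/esym/orP; right; apply: imset_f.
  rewrite cardsU !card_imset; [|by move=> a b []|by move=> a b []].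
  rewrite cardsT card_ord /d; lia.
have ginv x : x \in X -> exists w, (w \in W) && (f w == inl x).
  move=> xX; have : inl x \in f @: W by rewrite fim inE.
  by case/imsetP=> w wW E; exists w; rewrite wW E eqxx.
pose g x := if [pick w | (w \in W) && (f w == inl x)] is Some w then w else x.
have gP x : x \in X -> g x \in W /\ f (g x) = inl x.
  move=> /ginv[w hw]; rewrite /g; case: pickP => [w' /andP[-> /eqP]//|].
  by move/(_ w); rewrite hw.
exists g; split.
- move=> x x' /gP[_ h] /gP[_ h'] E.
  by move: h'; rewrite -E h => -[].
- move=> x xX; have [gW fg] := gP _ xX; split=> //.
  by have := fr _ gW; rewrite fg /= => /andP[].
- apply/subsetP => y yY; have yW := subsetP YW _ yY.
  have := fr _ yW; rewrite /r; case E: (f y) => [x|i]; last by rewrite yY.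
  case/andP=> _ xX; apply/imsetP; exists x => //.
  by have [gW fg] := gP _ xX; apply: finj => //; rewrite E fg.
Qed.

(** * Perfectly matchable vertex sets and maximal matchings *)

Section Matchings.

Variables (T : finType) (e : rel T).
Hypotheses (e_sym : symmetric e) (e_irr : irreflexive e).
Implicit Types (A B U V W S : {set T}) (M : {set {set T}}).

(** A perfect matching is encoded by its partner function, a fixed-point-free involution of [U];
    this makes unions and restrictions easy, and [pm_matching] returns to sets of edges. *)
Definition perfectly_matchable U : Prop :=
  exists h : T -> T, {in U, forall x, [/\ h x \in U, e x (h x) & h (h x) = x]}.

Local Notation pm := perfectly_matchable.

Definition independent A : Prop := {in A &, forall x y, ~~ e x y}.

Lemma edge_neq x y : e x y -> x != y.
Proof. by apply: contraTneq => ->; rewrite e_irr. Qed.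

Lemma pm0 : pm set0.
Proof. by exists id => x; rewrite inE. Qed.

Lemma pm_edge x y : e x y -> pm [set x; y].
Proof.
move=> exy; have nxy := edge_neq exy.
exists (fun z => if z == x then y else x) => z /set2P[] ->.
  by rewrite eqxx eq_sym (negbTE nxy) !inE eqxx orbT.
by rewrite eq_sym (negbTE nxy) eqxx !inE eqxx e_sym.
Qed.

Lemma pmU U V : pm U -> pm V -> [disjoint U & V] -> pm (U :|: V).
Proof.
move=> [h hP] [g gP] /pred0P dis.
exists (fun x => if x \in U then h x else g x) => x; rewrite in_setU.
have [xU _|xU /= xV] := boolP (x \in U).
  by have [hU ehx hh] := hP _ xU; rewrite !inE hU.
have [gV egx gg] := gP _ xV.
have -> : (g x \in U) = false by have := dis (g x); rewrite /= gV andbT.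
by rewrite !inE gV orbT.
Qed.

Lemma pm_partner U x : pm U -> x \in U ->
  exists2 y, y \in U & e x y /\ pm (U :\: [set x; y]).
Proof.
move=> [h hP] xU; have [hU ehx hh] := hP _ xU.
exists (h x) => //; split=> //; exists h => z; rewrite !inE negb_or.
case/andP=> /andP[zx zhx] zU; have [hzU ehz hhz] := hP _ zU; split=> //.
rewrite hzU andbT negb_or; apply/andP; split.
  by apply: contra zhx => /eqP <-; rewrite hhz.
by apply: contra zx => /eqP E; rewrite -hhz E hh.
Qed.

Lemma card_edge B : B \in edges e -> #|B| = 2.
Proof. by case/imset2P=> x y _; rewrite inE => exy ->; rewrite cards2 edge_neq. Qed.

Lemma card_cover_matching M : matching e M -> #|cover M| = 2 * #|M|.
Proof.
case/andP=> /subsetP Me /eqP <-; rewrite (eq_bigr (fun _ => 2)).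
  by rewrite sum_nat_const mulnC.
by move=> B /Me /card_edge.
Qed.

Lemma pm_matching U : pm U -> exists2 M, matching e M & cover M = U.
Proof.
case=> h hP; exists [set [set x; h x] | x in U].
  apply/andP; split.
    apply/subsetP => _ /imsetP[x /hP[hU ehx _] ->].
    by apply/imset2P; exists x (h x); rewrite ?inE.
  apply/trivIsetP => _ _ /imsetP[x xU ->] /imsetP[y yU ->].
  have [hx _ hhx] := hP _ xU; have [hy _ hhy] := hP _ yU.
  apply: contraR => /pred0Pn[z /= /andP[/set2P zx /set2P zy]]; apply/eqP.
  case: zx zy => -> [] E.
  - by rewrite E.
  - by rewrite E hhy setUC.
  - by rewrite -E hhx setUC.
  - by rewrite -hhx E hhy.
apply/setP => z; apply/bigcupP/idP => [[_ /imsetP[x xU ->]]|zU].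
  by have [hx _ _] := hP _ xU; case/set2P=> ->.
by exists [set z; h z]; [apply: imset_f | rewrite !inE eqxx].
Qed.

Lemma pm_even U : pm U -> ~~ odd #|U|.
Proof. by case/pm_matching=> M /card_cover_matching cM <-; rewrite cM; lia. Qed.

Lemma pm_system S (h : T -> T) :
    {in S &, injective h} -> {in S, forall s, e s (h s) /\ h s \notin S} ->
  pm (S :|: h @: S).
Proof.
move=> hinj hP.
pose g x := if [pick s in S | h s == x] is Some s then s else x.
have gh s : s \in S -> g (h s) = s.
  move=> sS; rewrite /g; case: pickP => [s' /andP[s'S /eqP E]|/(_ s)].
    exact: hinj.
  by rewrite /= sS eqxx.
exists (fun x => if x \in S then h x else g x) => x; rewrite in_setU.
case: (boolP (x \in S)) => [xS _|xS /= /imsetP[s sS Ex]].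
  have [ehx hS] := hP _ xS; rewrite (negbTE hS) gh // inE (negbTE hS) /=.
  by rewrite imset_f.
have [ehx hS] := hP _ sS; rewrite Ex gh // sS inE sS; split=> //.
by rewrite e_sym.
Qed.

(** Greedy choice: as long as [A] contains an edge, take it and continue with the remaining
    vertices. *)
Lemma maximal_pm A :
  exists2 W : {set T}, W \subset A & pm W /\ independent (A :\: W).
Proof.
have [m] := ubnP #|A|; elim: m A => // m IH A; rewrite ltnS => leAm.
case: (boolP [exists x in A, [exists y in A, e x y]]) => [|noe].
  case/exists_inP=> x xA /exists_inP[y yA exy].
  have [|W WA [pW iW]] := IH (A :\: [set x; y]).
    have := cardsD A [set x; y]; rewrite (setIidPr _); last first.
      by apply/subsetP => z /set2P[] ->.
    have : 0 < #|A| by apply/card_gt0P; exists x.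
    by rewrite cards2 (edge_neq exy); lia.
  have dW : [disjoint W & [set x; y]].
    by rewrite disjoints_subset (subset_trans WA) // setDE subsetIr.
  exists (W :|: [set x; y]).
    rewrite subUset (subset_trans WA (subsetDl _ _)).
    by apply/subsetP => z /set2P[] ->.
  split; first exact: pmU pW (pm_edge exy) dW.
  by rewrite setUC -setDDl.
exists set0; first exact: sub0set.
split; first exact: pm0.
move=> x y; rewrite setD0 => xA yA; apply: contra noe => exy.
by apply/exists_inP; exists x => //; apply/exists_inP; exists y.
Qed.

(* Factor-criticality provides a matching that misses a single vertex, and all
   maximal matchings have the same size. *)
Lemma card_missed_le1 U : equimatchable e -> factor_critical e ->
  pm U -> independent (~: U) -> #|~: U| <= 1.
Proof.
move=> eqm fc /pm_matching[M mM cM] iU.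
have [->|[v _]] := set_0Vmem (~: U); first by rewrite cards0.
(* An edge of a larger matching that is not in [M] would lie in the independent set [~: U]. *)
have maxM : maximal_matching e M.
  apply/maxsetP; split=> // N mN /subsetP MN; apply/setP => B.
  apply/idP/idP => [BN|/MN //]; apply: contraT => BM.
  have /andP[/subsetP/(_ _ BN) Be /trivIsetP tN] := mN.
  have BU z : z \in B -> z \in ~: U.
    move=> zB; rewrite inE -cM; apply/bigcupP => -[B' B'M zB'].
    have nBB : B != B' by apply: contraNneq BM => ->.
    by have /pred0P/(_ z) := tN _ _ BN (MN _ B'M) nBB; rewrite /= zB zB'.
  case/imset2P: Be BU => x y _; rewrite inE => /andP[_ exy] -> BU.
  by have := iU x y; rewrite !BU ?inE ?eqxx ?orbT // exy => /(_ isT isT).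
have [_ maxcard] := eqm _ maxM.
have [N mN cN] := fc v.
have mN' : matching e N.
  case/andP: mN => /subsetP Ne tN; rewrite /matching tN andbT.
  apply/subsetP => B /Ne /imset2P[x y _]; rewrite inE => /and4P[_ _ _ exy] ->.
  by apply/imset2P; exists x y; rewrite ?inE.
have := maxcard _ mN'; have := card_cover_matching mN'.
have := card_cover_matching mM; rewrite cM cN => hU.
have := cardsC U; have := cardsC [set v]; rewrite cards1; lia.
Qed.

End Matchings.

(** * Components, separators and the consequences of k-connectedness *)

Section Components.

Variables (T : finType) (e : rel T).
Hypothesis (e_sym : symmetric e).
Implicit Types (A B C D S : {set T}).

Lemma connect_induced_equiv A :
  {in A & &, equivalence_rel (connect (induced e A))}.
Proof.
have symA : connect_sym (induced e A).
  by apply: sym_connect_sym => x y; rewrite /induced /= e_sym andbCA.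
move=> x y z _ _ _; split; first exact: connect0.
by move=> cxy; apply: same_connect.
Qed.

Lemma components_partition A : partition (components e A) A.
Proof. exact/equivalence_partitionP/connect_induced_equiv. Qed.

Lemma component_sub A C : C \in components e A -> C \subset A.
Proof.
by move=> CA; rewrite -(cover_partition (components_partition A)) bigcup_sup.
Qed.

Lemma component_gt0 A C : C \in components e A -> 0 < #|C|.
Proof.
case/and3P: (components_partition A) => _ _ n0 CA; rewrite card_gt0.
by apply: contraNneq n0 => <-.
Qed.

Lemma component_disjoint A C D :
  C \in components e A -> D \in components e A -> C != D -> [disjoint C & D].
Proof.
case/and3P: (components_partition A) => _ /trivIsetP tA _ CA DA; exact: tA.
Qed.

Lemma component_connect A C x y : C \in components e A -> x \in C ->
  y \in A -> (y \in C) = connect (induced e A) x y.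
Proof.
move=> CA xC yA; have xA := subsetP (component_sub CA) _ xC.
rewrite -(pblock_equivalence_partition (@connect_induced_equiv A)) //.
case/and3P: (components_partition A) => _ tA _.
by rewrite (def_pblock tA CA xC).
Qed.

Lemma component_closed A C x y : C \in components e A -> x \in C ->
  y \in A -> e x y -> y \in C.
Proof.
move=> CA xC yA exy; rewrite (component_connect CA xC) //.
by apply: connect1; rewrite /induced /= yA exy (subsetP (component_sub CA)).
Qed.

Lemma component_min A C B : C \in components e A -> B \subset C -> B != set0 ->
  (forall x y, x \in B -> y \in C -> e x y -> y \in B) -> B = C.
Proof.
move=> CA BC /set0Pn[x xB] clB; apply/eqP; rewrite eqEsubset BC /=.
have xC := subsetP BC _ xB; apply/subsetP => y yC.
have yA := subsetP (component_sub CA) _ yC.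
move: yC; rewrite (component_connect CA xC) // => /connectP[p].
elim: p x xB xC => [|z p IH] x xB xC /=; first by move=> _ ->.
case/andP=> /and3P[_ zA exz] pz; have zC := component_closed CA xC zA exz.
exact: IH (clB _ _ xB zC exz) zC pz.
Qed.

Lemma connected_min A B : connected e A -> B \subset A -> B != set0 ->
  (forall x y, x \in B -> y \in A -> e x y -> y \in B) -> B = A.
Proof.
rewrite /connected => /cards1P[C CE].
have EC : C = A.
  by rewrite -(cover_partition (components_partition A)) CE cover1.
have AA : A \in components e A by rewrite CE -EC set11.
move=> BA B0 clB.
exact: (component_min AA).
Qed.

(** Deleting fewer than [k] vertices would leave [A :|: B] connected, although [A] is closed under
    adjacency in it. *)
Lemma separator_card k A B : k_connected e k -> A != set0 -> B != set0 ->
    [disjoint A & B] -> (forall x y, x \in A -> y \in B -> ~~ e x y) ->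
  k <= #|~: (A :|: B)|.
Proof.
move=> [_ conn] A0 /set0Pn[b bB] /pred0P dis noe; rewrite leqNgt; apply/negP.
move/conn; rewrite setCK => /connected_min/(_ (subsetUl A B) A0) EA.
have : b \in A.
  rewrite EA ?in_setU ?bB ?orbT // => x y xA /setUP[//|yB] exy.
  by have := noe _ _ xA yB; rewrite exy.
by move=> bA; have := dis b; rewrite /= bA bB.
Qed.

Section Cut.

Variables (k : nat) (S C D : {set T}).
Hypotheses (conn : k_connected e k) (S_card : #|S| = k).
Hypotheses (compC : C \in components e (~: S))
  (compD : D \in components e (~: S)) (neqCD : C != D).

Let notS A x : A \in components e (~: S) -> x \in A -> x \notin S.
Proof. by move=> /component_sub/subsetP h /h; rewrite inE. Qed.

(** If [C] is not contained in [nbr e A], then [(S :\: A) :|: (nbr e A :&: C)] separates the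
    remaining part of [C] from [D], so it has at least [k = #|S|] vertices. *)
Lemma cut_nbr A : A \subset S -> minn #|A| #|C| <= #|nbr e A :&: C|.
Proof.
move=> AS; case: (boolP (C \subset nbr e A)) => [sC|nC].
  by rewrite (setIidPr sC) geq_minr.
apply: leq_trans (geq_minl _ _) _.
pose P := C :\: nbr e A; pose X := (S :\: A) :|: (nbr e A :&: C).
pose Q := ~: (P :|: X).
have [d dD] : exists d, d \in D by apply/card_gt0P/(component_gt0 compD).
have dC : d \notin C.
  by have /pred0P/(_ d) := component_disjoint compC compD neqCD; rewrite /= dD andbT => ->.
have := @separator_card k P Q conn.
have -> : ~: (P :|: Q) = X.
  rewrite setCU setCK setIUr (setIC _ P) setICr set0U.
  apply/setIidPr/subsetP => z; rewrite !in_setU !in_setI !in_setD in_setC in_setD.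
  case/orP=> [/andP[_ zS]|/andP[-> //]]; rewrite negb_and orbC.
  by case: (boolP (z \in C)) => // /(notS compC); rewrite zS.
have : #|X| <= #|S| - #|A| + #|nbr e A :&: C|.
  by rewrite cardsU cardsD (setIidPr AS) leq_subr.
have := subset_leq_card AS; rewrite S_card => leA leX h.
suff: k <= #|X| by lia.
apply: h.
- by rewrite setD_eq0.
- apply/set0Pn; exists d; rewrite in_setC !in_setU in_setI !in_setD.
  by rewrite (negbTE dC) (negbTE (notS compD dD)) !andbF.
- by rewrite disjoints_subset setCK subsetUl.
move=> x y /setDP[xC xN]; rewrite in_setC in_setU negb_or => /andP[yP yX].
apply/negP => exy; case: (boolP (y \in S)) => yS.
  case/negP: xN; apply/nbrP; exists y; last by rewrite e_sym.
  by apply: contraR yX => yA; rewrite in_setU in_setD yA yS.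
have yC : y \in C by apply: component_closed compC xC _ exy; rewrite inE.
case/negP: yP; rewrite in_setD yC andbT; apply: contra yX => yN.
by rewrite in_setU in_setI yN yC orbT.
Qed.

(** The neighbours of [A] in [S] together with [C :\: A] separate [A] from [D]. *)
Lemma component_nbr A : A \subset C -> A != set0 ->
  k <= #|nbr (fun y x => e x y) A :&: S| + (#|C| - #|A|).
Proof.
move=> AC A0; pose X := (nbr (fun y x => e x y) A :&: S) :|: (C :\: A).
pose Q := ~: (A :|: X).
have [d dD] : exists d, d \in D by apply/card_gt0P/(component_gt0 compD).
have dC : d \notin C.
  by have /pred0P/(_ d) := component_disjoint compC compD neqCD; rewrite /= dD andbT => ->.
have := @separator_card k A Q conn A0.
have -> : ~: (A :|: Q) = X.
  rewrite setCU setCK setIUr (setIC _ A) setICr set0U.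
  apply/setIidPr/subsetP => z; rewrite !in_setU !in_setI in_setC in_setD.
  case/orP=> [/andP[_ zS]|/andP[-> //]].
  by apply: contraL zS => zA; apply: (notS compC); apply: (subsetP AC).
have : #|X| <= #|nbr (fun y x => e x y) A :&: S| + (#|C| - #|A|).
  by rewrite cardsU cardsD (setIidPr AC) leq_subr.
move=> leX h; apply: leq_trans leX; apply: h.
- apply/set0Pn; exists d; rewrite in_setC !in_setU in_setI !in_setD.
  rewrite (negbTE dC) (negbTE (notS compD dD)) !andbF !orbF.
  by apply: contra dC; apply: (subsetP AC).
- by rewrite disjoints_subset setCK subsetUl.
move=> x y xA; rewrite in_setC in_setU negb_or => /andP[yA yX].
apply/negP => exy; case/negP: yX; rewrite in_setU in_setI in_setD yA /=.
case: (boolP (y \in S)) => yS.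
  by apply/orP; left; rewrite andbT; apply/nbrP; exists x; rewrite // e_sym.
apply/orP; right.
by apply: (component_closed compC) exy; rewrite ?inE ?(subsetP AC).
Qed.

End Cut.

End Components.

(** * Randomly matchable sets and extension by two vertices *)

Section RandomlyMatchable.

Variables (T : finType) (e : rel T).
Hypotheses (e_sym : symmetric e) (e_irr : irreflexive e).
Implicit Types (V X Z : {set T}).

Local Notation pm := (perfectly_matchable e).

(** Sumner's randomly matchable graphs, where every matching extends to a perfect one; here a
    matching is represented by the set [V] that it covers. *)
Definition randomly_matchable X : Prop :=
  forall V, V \subset X -> pm V -> pm (X :\: V).

Lemma randomly_matchable_pm X : randomly_matchable X -> pm X.
Proof. by move/(_ set0); rewrite setD0; apply; [apply: sub0set | apply: pm0]. Qed.

(** Once [V] is matched, [b] is the only possible partner of [a]. *)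
Lemma pm_last X V a b : randomly_matchable X -> V \subset X -> pm V ->
  a \in X :\: V -> (forall z, z \in X -> [|| z \in V, z == a | z == b]) -> e a b.
Proof.
move=> rX VX pV aXV hV; have [y] := pm_partner (rX _ VX pV) aXV.
rewrite inE => /andP[yV yX] [eay _]; have := hV _ yX; rewrite (negbTE yV) /=.
case/orP=> /eqP yE; last by rewrite -yE.
by move: eay; rewrite yE e_irr.
Qed.

Variables (Z : {set T}) (a b : T).
Hypotheses (rZ : randomly_matchable Z)
  (rZab : randomly_matchable (Z :|: [set a; b])).
Hypotheses (neq_ab : a != b) (aZ : a \notin Z) (bZ : b \notin Z).

Lemma randomly_matchable_edge : e a b.
Proof.
apply: (pm_last rZab (subsetUl _ _) (randomly_matchable_pm rZ)).
  by rewrite !inE eqxx aZ orbT.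
by move=> z; rewrite !inE.
Qed.

Let neqZ x z : x \notin Z -> z \in Z -> (x == z = false) * (z == x = false).
Proof.
move=> xZ zZ; have nxz : x != z by apply: contraNneq xZ => ->.
by split; last rewrite eq_sym; apply/negbTE.
Qed.

Let nab : (a == b = false) * (b == a = false).
Proof. by split; last rewrite eq_sym; apply/negbTE. Qed.

(** In a perfect matching of [Z] through [p q], replace this edge by [a p]; only [q] and [b] remain,
    and they must be adjacent. *)
Lemma randomly_matchable_shift p q : p \in Z -> q \in Z -> e p q -> e a p -> e b q.
Proof.
move=> pZ qZ epq eap; have npq := edge_neq e_irr epq.
have pqZ : [set p; q] \subset Z by apply/subsetP => z /set2P[] ->.
have pV := rZ pqZ (pm_edge e_sym e_irr epq).
have pW : pm (Z :\: [set p; q] :|: [set a; p]).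
  apply: pmU pV (pm_edge e_sym e_irr eap) _.
  rewrite disjoints_subset; apply/subsetP => z.
  rewrite !inE !negb_or => /andP[/andP[-> _] zZ].
  by rewrite (neqZ aZ zZ).
apply: (pm_last rZab _ pW).
- apply/subsetP => z; rewrite !inE => /orP[/andP[_ ->] //|/orP[] /eqP ->].
    by rewrite eqxx orbT.
  by rewrite pZ.
- rewrite !inE eqxx (negbTE bZ) (neqZ bZ pZ) nab.
  by rewrite !andbF !orbT.
- move=> z; rewrite !inE.
  by case: (z == a); case: (z == b); case: (z == p); case: (z == q);
     case: (z \in Z).
Qed.

(** In a perfect matching of [Z] let [p1] and [q1] be the partners of [p] and [q]. Replacing these
    two edges by [a p1] and [b q1] leaves only [p] and [q], which must be adjacent. *)
Lemma randomly_matchable_clique p q : {in Z, forall z, e a z && e b z} ->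
  p \in Z -> q \in Z -> p != q -> e p q.
Proof.
move=> ab pZ qZ npq; have pmZ := randomly_matchable_pm rZ.
have [p1 p1Z [epp1 pmZ1]] := pm_partner pmZ pZ.
have [<- //|np1q] := eqVneq p1 q.
have qZ1 : q \in Z :\: [set p; p1].
  by rewrite !inE qZ eq_sym (negbTE npq) eq_sym (negbTE np1q).
have [q1 q1Z1 [eqq1 pmZ2]] := pm_partner pmZ1 qZ1.
have nq1 := edge_neq e_irr eqq1; have np1 := edge_neq e_irr epp1.
have [/norP[nq1p nq1p1] q1Z] : ~~ ((q1 == p) || (q1 == p1)) /\ q1 \in Z.
  by move: q1Z1; rewrite !inE => /andP[].
have /andP[eap1 _] := ab _ p1Z; have /andP[_ ebq1] := ab _ q1Z.
set V := _ :\: [set q; q1] in pmZ2.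
have VZ z : z \in V -> [/\ z \in Z, z != p1 & z != q1].
  by rewrite !inE !negb_or => /andP[/andP[_ ->] /andP[/andP[_ ->] ->]].
have pV1 : pm (V :|: [set a; p1]).
  apply: pmU pmZ2 (pm_edge e_sym e_irr eap1) _.
  rewrite disjoints_subset; apply/subsetP => z /VZ[zZ zp1 _].
  by rewrite inE !inE (neqZ aZ zZ).
have pV2 : pm (V :|: [set a; p1] :|: [set b; q1]).
  apply: pmU pV1 (pm_edge e_sym e_irr ebq1) _.
  rewrite disjoints_subset; apply/subsetP => z /setUP[/VZ[zZ _ zq1]|].
    by rewrite inE !inE (neqZ bZ zZ).
  by case/set2P=> ->; rewrite inE !inE ?(neqZ aZ q1Z) ?(neqZ bZ p1Z) ?nab // eq_sym.
apply: (pm_last rZab _ pV2).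
- apply/subsetP => z zV; rewrite in_setU.
  case/setUP: zV => [/setUP[/VZ[-> //]|]|] /set2P[] ->.
  + by rewrite !inE eqxx orbT.
  + by rewrite p1Z.
  + by rewrite !inE eqxx !orbT.
  + by rewrite q1Z.
- rewrite !inE pZ eqxx !(neqZ aZ pZ) !(neqZ bZ pZ) (negbTE np1).
  by rewrite eq_sym in nq1p; rewrite (negbTE nq1p) /= andbF.
- move=> z; rewrite !inE.
  by case: (z == a); case: (z == b); case: (z == p); case: (z == q);
     case: (z == p1); case: (z == q1); case: (z \in Z).
Qed.

End RandomlyMatchable.

(** * A component is a clique if its variable rests are randomly matchable *)

Section Clique.

Variables (T : finType) (e : rel T) (A C S : {set T}) (f : T -> T) (c : bool).
Hypotheses (e_sym : symmetric e) (e_irr : irreflexive e).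
Hypotheses (compC : C \in components e A) (S_card : 3 <= #|S|).
Hypotheses (f_inj : {in S &, injective f}) (fC : f @: S \subset C).

Let L := C :\: f @: S.
(* [c] is the parity of [L], so that [Z l] has even cardinality. *)
Let Z l := if c then f l |: L else L.

Hypothesis rZ : {in S, forall l, randomly_matchable e (Z l)}.
Hypothesis rZ2 : forall i j l, i \in S -> j \in S -> l \in S ->
  i != j -> l != i -> l != j -> randomly_matchable e (Z l :|: [set f i; f j]).

Let third i j : exists2 l, l \in S & (l != i) /\ (l != j).
Proof.
have /card_gt0P[l] : 0 < #|S :\: [set i; j]|.
  rewrite cardsD subn_gt0; apply: leq_trans S_card.
  by apply: leq_ltn_trans (subset_leq_card (subsetIr _ _)) _; rewrite cards2; case: (_ != _).
by rewrite !inE negb_or => /andP[/andP[li lj] lS]; exists l.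
Qed.

Let fL i : i \in S -> f i \notin L.
Proof. by move=> iS; rewrite inE imset_f. Qed.

Let fZ i l : i \in S -> l \in S -> l != i -> f i \notin Z l.
Proof.
move=> iS lS li; rewrite /Z; case: c; last exact: fL.
rewrite in_setU1 negb_or fL // andbT.
by apply: contra li => /eqP/f_inj ->.
Qed.

Let LZ l : L \subset Z l.
Proof. by rewrite /Z; case: c; rewrite ?subsetUr. Qed.

Let f_neq i j : i \in S -> j \in S -> i != j -> f i != f j.
Proof. by move=> iS jS; apply: contra => /eqP/f_inj ->. Qed.

Let f_clique i j : i \in S -> j \in S -> i != j -> e (f i) (f j).
Proof.
move=> iS jS ij; have [l lS [li lj]] := third i j.
by apply: (randomly_matchable_edge e_irr (rZ lS) (rZ2 iS jS lS _ _ _));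
   rewrite ?f_neq ?fZ.
Qed.

Let shift i j l p q : i \in S -> j \in S -> l \in S ->
  i != j -> l != i -> l != j -> p \in Z l -> q \in Z l ->
  e p q -> e (f i) p -> e (f j) q.
Proof.
move=> iS jS lS ij li lj.
by apply: (randomly_matchable_shift e_sym e_irr (rZ lS) (rZ2 iS jS lS _ _ _));
   rewrite ?f_neq ?fZ.
Qed.

(** With a partner [q] of [p] in [Z j], two shifts carry the adjacency from [f i] to [f l] and on to
    [f j], unless [q] is [f j] itself. *)
Let spread p i j : p \in L -> i \in S -> j \in S -> e (f i) p -> e (f j) p.
Proof.
move=> pL iS jS eip; have [<- //|ij] := eqVneq i j.
have [l lS [li lj]] := third i j.
have pZ m : p \in Z m by apply: (subsetP (LZ m)).
have [q qZ [epq _]] := pm_partner (randomly_matchable_pm (rZ jS)) (pZ j).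
have elq : e (f l) q.
  by apply: (shift iS lS jS) epq eip; rewrite // eq_sym.
have [qL|qL] := boolP (q \in L).
  rewrite e_sym in epq; apply: (shift lS jS iS) epq elq; rewrite // 1?eq_sym //.
  exact: (subsetP (LZ i)).
move: qZ; rewrite /Z; case: c; rewrite ?in_setU1 (negbTE qL) ?orbF //.
by move/eqP => <-; rewrite e_sym.
Qed.

(** The set [f @: S] together with the vertices of [L] that have a neighbour in it is closed under
    adjacency, hence it is all of [C]; [spread] then gives every adjacency between [L] and
    [f @: S]. *)
Let joined : {in L & S, forall p j, e (f j) p}.
Proof.
have [s0 s0S] : exists s, s \in S by apply/card_gt0P; lia.
pose B := f @: S :|: [set p in L | [exists i in S, e (f i) p]].
have BC : B = C.
  apply: (component_min e_sym compC).
  - rewrite subUset fC; apply/subsetP => p; rewrite !inE.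
    by case/andP=> /andP[].
  - by apply/set0Pn; exists (f s0); rewrite in_setU imset_f.
  move=> x y xB yC exy; rewrite in_setU; case: (boolP (y \in f @: S)) => //= yf.
  have yL : y \in L by rewrite inE yf.
  rewrite inE yL; apply/exists_inP; case/setUP: xB => [/imsetP[i iS xE]|].
    by exists i; rewrite -?xE.
  (* For an edge [x y] inside [L], a shift turns a neighbour [f i] of [x] into a neighbour [f j] of
     [y]. *)
  rewrite inE => /andP[xL /exists_inP[i iS eix]].
  have [j jS [ji _]] := third i i; have [l lS [li lj]] := third i j.
  exists j => //; apply: (shift iS jS lS) exy eix; rewrite // 1?eq_sym //.
    exact: (subsetP (LZ l)).
  exact: (subsetP (LZ l)).
move=> p j pL jS; have : p \in B by rewrite BC; case/setDP: pL.
rewrite in_setU inE; case/orP=> [pf|/andP[_ /exists_inP[i iS eip]]].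
  by move: pL; rewrite inE pf.
exact: spread eip.
Qed.

Lemma randomly_matchable_complete : complete e C.
Proof.
move=> x y xC yC nxy.
have [/imsetP[i iS xE]|xf] := boolP (x \in f @: S);
have [/imsetP[j jS yE]|yf] := boolP (y \in f @: S).
- by rewrite xE yE f_clique //; apply: contraNneq nxy => ij; rewrite xE yE ij.
- by rewrite xE joined // inE yf.
- by rewrite yE e_sym joined // inE xf.
have [i iS _] := third x y; have [j jS [ji _]] := third i i.
have [l lS [li lj]] := third i j; rewrite eq_sym in ji.
apply: (@randomly_matchable_clique _ _ e_sym e_irr (Z l) (f i) (f j)) => //.
- exact: rZ.
- exact: rZ2.
- exact: f_neq.
- exact: fZ.
- exact: fZ.
- move=> z; rewrite /Z => zZ; have [zL|zL] := boolP (z \in L).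
    by rewrite !joined.
  move: zZ; case: c; rewrite ?in_setU1 (negbTE zL) ?orbF // => /eqP ->.
  by rewrite !f_clique // eq_sym.
- by apply: (subsetP (LZ l)); rewrite inE xf.
- by apply: (subsetP (LZ l)); rewrite inE yf.
Qed.

End Clique.

(** * Parity of the component rests in an equimatchable factor-critical graph *)

Section EquimatchableCut.

Variables (T : finType) (e : rel T) (k : nat) (S : {set T}).
Hypotheses (e_sym : symmetric e) (e_irr : irreflexive e).
Hypotheses (G_eqm : equimatchable e) (G_fc : factor_critical e).
Hypotheses (conn : k_connected e k) (S_card : #|S| = k).
Hypotheses (S_cut : vertex_cut e S) (k_ge3 : 3 <= k)
  (G_card : 2 * k + 3 <= #|T|).
Implicit Types (A B C D E J P U V W X Y : {set T}) (h : T -> T).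

Local Notation pm := (perfectly_matchable e).
Local Notation comp C := (C \in components e (~: S)).

Let compS C x : comp C -> x \in C -> x \notin S.
Proof. by move/(component_sub e_sym)/subsetP => sC /sC; rewrite inE. Qed.

Let comp_disjoint C D : comp C -> comp D -> C != D -> [disjoint C & D].
Proof. exact: component_disjoint. Qed.

Let comp_disj C D x : comp C -> comp D -> C != D -> x \in C -> x \notin D.
Proof.
move=> cC cD nCD xC; apply/negP => xD.
by have /pred0P/(_ x) := component_disjoint e_sym cC cD nCD; rewrite /= xC xD.
Qed.

Lemma pm_component C W : comp C -> W \subset ~: S -> pm W -> pm (W :&: C).
Proof.
move=> cC /subsetP WS [h hP]; exists h => x /setIP[xW xC].
have [hW exh hh] := hP _ xW; split=> //; rewrite inE hW.
exact: (component_closed e_sym cC xC (WS _ hW) exh).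
Qed.

Lemma pm_near_cover U : pm U -> S \subset U ->
  exists W, [/\ W \subset ~: U, #|~: U :\: W| <= 1 &
                forall C, comp C -> pm (W :&: C)].
Proof.
move=> pU SU; have [W WU [pW iW]] := maximal_pm e_sym e_irr (~: U).
exists W; split=> // [|C cC].
  have eU : ~: (U :|: W) = ~: U :\: W by rewrite setCU setDE.
  rewrite -eU; apply: (card_missed_le1 e_irr G_eqm G_fc); last by rewrite eU.
  by apply: pmU pU pW _; rewrite disjoint_sym disjoints_subset.
by apply: pm_component => //; apply: subset_trans WU _; rewrite setCS.
Qed.

(** Each odd rest contains a missed vertex, and only one vertex may be missed. *)
Lemma not_two_odd_components U C D : pm U -> S \subset U ->
  comp C -> comp D -> C != D -> ~~ (odd #|C :\: U| && odd #|D :\: U|).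
Proof.
move=> pU SU cC cD nCD; apply/negP => /andP[oC oD].
have [W [/subsetP WU leW pW]] := pm_near_cover pU SU.
have WU' x : x \in W -> x \in U = false by move/WU; rewrite inE => /negbTE.
have missed E : comp E -> odd #|E :\: U| -> exists2 x, x \in E & x \in ~: U :\: W.
  move=> cE oE; have /card_gt0P[x] : 0 < #|(E :\: U) :\: W|.
    rewrite card_gt0; apply/negP => /eqP E0.
    have EW : E :\: U = W :&: E.
      apply/setP => x; have := in_set0 x; rewrite -E0 !inE.
      by case: (boolP (x \in W)) => [/WU' ->|].
    by have := pm_even e_irr (pW _ cE); rewrite -EW oE.
  by rewrite !inE => /and3P[xW xU xE]; exists x; rewrite ?inE ?xW.
have [x xC xW] := missed _ cC oC; have [y yD yW] := missed _ cD oD.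
have : [set x; y] \subset ~: U :\: W by apply/subsetP => z /set2P[] ->.
move/subset_leq_card; rewrite cards2.
suff -> : x != y by move=> h; have := leq_trans h leW.
by apply: contraNneq (comp_disj cC cD nCD xC) => ->.
Qed.

(** At most one vertex of the rest is missed, and by parity none is. *)
Lemma pm_component_rest U C : pm U -> S \subset U -> comp C ->
  ~~ odd #|C :\: U| -> pm (C :\: U).
Proof.
move=> pU SU cC evC; have [W [/subsetP WU leW pW]] := pm_near_cover pU SU.
have WU' x : x \in W -> x \in U = false by move/WU; rewrite inE => /negbTE.
suff E0 : (C :\: U) :\: W = set0.
  suff -> : C :\: U = W :&: C by apply: pW.
  apply/setP => x; have := in_set0 x; rewrite -E0 !inE.
  by case: (boolP (x \in W)) => [/WU' ->|].
have := pm_even e_irr (pW _ cC).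
have -> : W :&: C = (C :\: U) :&: W.
  apply/setP => x; rewrite !inE.
  by case: (boolP (x \in W)) => [/WU' ->|]; rewrite ?andbT ?andbF.
have : #|(C :\: U) :\: W| <= 1.
  by apply: leq_trans leW; rewrite subset_leq_card // setSD // setDE subsetIr.
have := cardsID W (C :\: U); move=> cE le1 evW.
by apply/eqP; rewrite -cards_eq0; lia.
Qed.

(** * Matchings of the cut into its complement *)

Definition matching_out h : Prop :=
  {in S &, injective h} /\ {in S, forall s, e s (h s) /\ h s \notin S}.

Lemma not_two_odd_components_out h C D : matching_out h ->
  comp C -> comp D -> C != D -> ~~ (odd #|C :\: h @: S| && odd #|D :\: h @: S|).
Proof.
move=> [h_inj hP] cC cD nCD; have pU := pm_system e_sym h_inj hP.
have := not_two_odd_components pU (subsetUl _ _) cC cD nCD.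
have rest E : comp E -> E :\: (S :|: h @: S) = E :\: h @: S.
  move=> cE; apply/setP => x; rewrite !inE negb_or.
  by case: (boolP (x \in E)) => [/(compS cE) ->|]; rewrite ?andbF.
by rewrite !rest.
Qed.

(** This makes an even rest [C :\: h @: S] randomly matchable: add [V] to the matched set
    [S :|: h @: S]. *)
Lemma pm_component_out h C V : matching_out h -> comp C ->
    V \subset C :\: h @: S -> pm V -> ~~ odd #|C :\: h @: S| ->
  pm ((C :\: h @: S) :\: V).
Proof.
move=> [h_inj hP] cC VC pV evC.
have pU : pm (S :|: h @: S :|: V).
  apply: pmU (pm_system e_sym h_inj hP) pV _.
  rewrite disjoint_sym disjoints_subset; apply: subset_trans VC _.
  apply/subsetP => x; rewrite !inE negb_or => /andP[-> xC].
  by rewrite (compS cC xC).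
have rest : C :\: (S :|: h @: S :|: V) = (C :\: h @: S) :\: V.
  apply/setP => x; rewrite !inE !negb_or.
  by case: (boolP (x \in C)) => [/(compS cC) ->|]; rewrite ?andbF // !andbT andbC.
rewrite -rest; apply: pm_component_rest => //.
  by rewrite -setUA subsetUl.
rewrite rest; have := pm_even e_irr pV.
have := cardsID V (C :\: h @: S); rewrite (setIidPr VC).
by move: evC; lia.
Qed.

Lemma matching_out_into B : B \subset ~: S ->
    (forall A, A \subset S -> #|A| <= #|nbr e A :&: B|) ->
  exists2 h : T -> T, matching_out h & h @: S \subset B.
Proof.
move=> /subsetP BS hB.
have [s0 s0S] : exists s, s \in S by apply/card_gt0P; rewrite S_card; lia.
have [|h [h_inj hP]] := @hall _ _ s0 (fun x y => e x y && (y \in B)) S.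
  move=> A /hB; congr (_ <= #|pred_of_set _|).
  apply/setP => y; rewrite in_setI; apply/andP/nbrP.
    by case=> /nbrP[x xA exy] yB; exists x => //; rewrite exy.
  by case=> x xA /andP[exy yB]; split=> //; apply/nbrP; exists x.
exists h; last by apply/subsetP => _ /imsetP[s /hP/andP[_ ?] ->].
by split=> // s /hP/andP[-> /BS]; rewrite inE.
Qed.

Let other C : comp C -> exists2 D, comp D & C != D.
Proof.
move=> cC; have : 0 < #|components e (~: S) :\ C|.
  by move: S_cut; rewrite /vertex_cut (cardsD1 C) cC.
by case/card_gt0P=> D; rewrite !inE => /andP[nDC cD]; exists D; rewrite // eq_sym.
Qed.

Lemma cut_nbr_component C A : comp C -> A \subset S ->
  minn #|A| #|C| <= #|nbr e A :&: C|.
Proof.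
by move=> cC; have [D cD nCD] := other cC; apply: (cut_nbr e_sym conn S_card cC cD nCD).
Qed.

Lemma component_nbr_cut C A : comp C -> A \subset C -> A != set0 ->
  k <= #|nbr (fun y x => e x y) A :&: S| + (#|C| - #|A|).
Proof.
by move=> cC; have [D cD nCD] := other cC; apply: (component_nbr e_sym conn cC cD nCD).
Qed.

(** By [cut_nbr_component], one component outside [X] with at least [#|A|] vertices already gives
    enough neighbours; if there is none, every component outside [X] consists of neighbours. *)
Lemma cut_nbr_rest X A :
    (forall E, comp E -> E \subset X \/ [disjoint E & X]) -> A \subset S ->
  #|A| <= #|nbr e A :&: (~: S :\: X)| \/ ~: S :\: X \subset nbr e A.
Proof.
move=> hX AS.
have [/exists_inP[E cE /andP[dEX leAE]]|noE] :=
  boolP [exists E in components e (~: S), [disjoint E & X] && (#|A| <= #|E|)].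
  left; have := cut_nbr_component cE AS; rewrite (minn_idPl leAE) => /leq_trans.
  apply; rewrite subset_leq_card // setIS //; apply/subsetP => x xE.
  rewrite inE (subsetP (component_sub e_sym cE)) // andbT.
  by have /pred0P/(_ x) := dEX; rewrite /= xE /= => ->.
right; apply/subsetP => z; rewrite inE => /andP[zX].
rewrite -(cover_partition (components_partition e_sym (~: S))).
case/bigcupP=> E cE zE; have [/subsetP/(_ _ zE)|dEX] := hX _ cE.
  by rewrite (negbTE zX).
have ltEA : #|E| < #|A|.
  rewrite ltnNge; apply: contra noE => leAE.
  by apply/exists_inP; exists E; rewrite // dEX.
have := cut_nbr_component cE AS; rewrite (minn_idPr (ltnW ltEA)) => leE.
have /setIidPr/subsetP sE : nbr e A :&: E = E.
  by apply/eqP; rewrite eqEcard subsetIr.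
exact: sE.
Qed.

Let card_rest : k + 3 <= #|~: S|.
Proof. by have := cardsC S; rewrite S_card; lia. Qed.

(** In the second case of [cut_nbr_rest] all vertices outside [X] count, and [P] costs at most two
    of those inside. The bound is additive to avoid truncated subtraction. *)
Lemma cut_nbr_avoid X P A :
    (forall E, comp E -> E \subset X \/ [disjoint E & X]) ->
    X \subset ~: S -> P \subset X -> #|P| <= 2 -> A \subset S ->
  #|A| <= #|nbr e A :&: (~: S :\: P)| \/
  #|~: S| + #|nbr e A :&: X| <= #|nbr e A :&: (~: S :\: P)| + 2 + #|X|.
Proof.
move=> hX XS PX leP AS; have [leA|sA] := cut_nbr_rest hX AS; [left|right].
  by apply: leq_trans leA _; rewrite subset_leq_card // setIS // setDS.
have sub : (~: S :\: X) :|: ((nbr e A :&: X) :\: P) \subset nbr e A :&: (~: S :\: P).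
  rewrite subUset subsetI sA setDS //=; apply/subsetP => z.
  case/setDP=> /setIP[zN zX] zP.
  by rewrite in_setI in_setD zN zP (subsetP XS).
have dis : (~: S :\: X) :&: ((nbr e A :&: X) :\: P) = set0.
  by apply/setP => z; rewrite in_setI !in_setD in_setI in_set0; case: (z \in X); rewrite ?andbF.
have := subset_leq_card sub; rewrite cardsU dis cards0 subn0 cardsD (setIidPr XS).
have := cardsID P (nbr e A :&: X); have := subset_leq_card XS.
have := subset_leq_card (subsetIr (nbr e A :&: X) P); lia.
Qed.

Lemma matching_out_covering P Y : P \subset ~: S -> Y \subset ~: S :\: P ->
    (forall A, A \subset S -> #|A| <= #|nbr e A :&: (~: S :\: P)|) ->
    (forall A, A \subset Y -> #|A| <= #|nbr (fun y x => e x y) A :&: S|) ->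
  exists2 h : T -> T, matching_out h & Y \subset h @: S /\ [disjoint P & h @: S].
Proof.
move=> PS YW hX hY; have [h [h_inj hP Yh]] := mendelsohn_dulmage YW hX hY.
exists h.
  split=> // s /hP[esh]; rewrite !inE => /andP[_ ->].
  by [].
split=> //; rewrite disjoints_subset; apply/subsetP => p pP; rewrite inE.
by apply/imsetP => -[s /hP[_]]; rewrite inE => /andP[hs _] pE; rewrite -pE pP in hs.
Qed.

(** Match [S] so that exactly [x] and [y] remain of [C]; this even rest is perfectly matchable, so
    [x] and [y] are adjacent. *)
Lemma small_component_complete C : comp C -> #|C| <= k -> 3 <= #|~: S :\: C| ->
  complete e C.
Proof.
move=> cC leCk le3 x y xC yC nxy; pose P := [set x; y].
have PC : P \subset C by apply/subsetP => z /set2P[] ->.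
have CS := component_sub e_sym cC.
have cardP : #|P| = 2 by rewrite cards2 nxy.
have hC E : comp E -> E \subset C \/ [disjoint E & C].
  move=> cE; have [->|nEC] := eqVneq E C; first by left.
  by right; apply: component_disjoint cE cC nEC.
have cardSC : #|~: S :\: C| = #|~: S| - #|C| by rewrite cardsD (setIidPr CS).
have [||A AS|A AY|h hout [Yh Ph]] := @matching_out_covering P (C :\: P).
- exact: subset_trans CS.
- exact: setSD.
(* If [#|A| <= #|C|], the three vertices outside [C] make up for the two of [P]; otherwise all of
   [C] is adjacent to [A], and [k + 3 <= #|~: S|] suffices. *)
- have := cut_nbr_component cC AS; have := subset_leq_card AS.
  have := @cut_nbr_avoid C P A hC CS PC _ AS; rewrite cardP => /(_ isT)[//|].
  have := subset_leq_card CS; rewrite S_card; lia.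
(* Here [#|C| <= k] turns the separator bound into Hall's condition. *)
- have [->|A0] := eqVneq A set0; first by rewrite cards0.
  have AC : A \subset C by apply: subset_trans AY (subsetDl _ _).
  have := component_nbr_cut cC AC A0; have := subset_leq_card AC; lia.
have rest : C :\: h @: S = P.
  apply/setP => z; rewrite in_setD; apply/andP/idP => [[zh zC]|zP].
    by apply: contraNT zh => zP; apply: (subsetP Yh); rewrite inE zP.
  split; last exact: (subsetP PC).
  by have /pred0P/(_ z) := Ph; rewrite /= zP /= => ->.
have := pm_component_out hout cC (sub0set _) (pm0 e); rewrite setD0 rest cardP.
move=> /(_ isT) pP; have [z zP [exz _]] := pm_partner pP (set21 x y).
by case/set2P: zP exz => ->; rewrite ?e_irr.
Qed.

(** Otherwise [S] could be matched so that a single vertex of [C] and a single vertex of [D] remain,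
    giving two odd rests. *)
Lemma two_small_components C D E : comp C -> comp D -> comp E -> C != D ->
  E != C -> E != D -> k + 1 < #|C| + #|D|.
Proof.
move=> cC cD cE nCD nEC nED; rewrite ltnNge; apply/negP => leCD.
have [x xC] : exists x, x \in C by apply/card_gt0P/(component_gt0 e_sym cC).
have [y yD] : exists y, y \in D by apply/card_gt0P/(component_gt0 e_sym cD).
have gtC := component_gt0 e_sym cC; have gtD := component_gt0 e_sym cD.
have gtE := component_gt0 e_sym cE.
pose P := [set x; y]; pose X := C :|: D.
have PX : P \subset X by apply/subsetP => z /set2P[] ->; rewrite inE ?xC ?yD ?orbT.
have XS : X \subset ~: S by rewrite subUset !(component_sub e_sym).
have dCD : C :&: D = set0 by apply/eqP; rewrite setI_eq0 (component_disjoint e_sym cC cD).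
have cardX : #|X| = #|C| + #|D| by rewrite cardsU dCD cards0 subn0.
have cardXE : #|X| + #|E| <= #|~: S|.
  have <- : #|X :|: E| = #|X| + #|E|.
    rewrite cardsU setIUl; have -> : C :&: E = set0.
      by apply/eqP; rewrite setI_eq0 comp_disjoint // eq_sym.
    have -> : D :&: E = set0.
      by apply/eqP; rewrite setI_eq0 comp_disjoint // eq_sym.
    by rewrite setU0 cards0 subn0.
  by rewrite subset_leq_card // subUset XS (component_sub e_sym).
have leP : #|P| <= 2 by rewrite cards2; case: (_ != _).
have hX F : comp F -> F \subset X \/ [disjoint F & X].
  move=> cF; have [->|nFC] := eqVneq F C; first by left; apply: subsetUl.
  have [->|nFD] := eqVneq F D; first by left; apply: subsetUr.
  by right; rewrite -setI_eq0 setIUr !disjoint_setI0 ?setU0 ?comp_disjoint.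
(* Since [A] misses a vertex of [F'], [#|A :&: F'|] is at most [k - #|F|], exactly the surplus that
   the separator bound gives for [A :&: F]. *)
have leN A F (F' : {set T}) : comp F -> #|F| + #|F'| <= k + 1 -> A :&: F != set0 ->
    #|A :&: F'| < #|F'| ->
    #|A :&: F| + #|A :&: F'| <= #|nbr (fun y x => e x y) A :&: S|.
  move=> cF leFF' AF0 ltAF'.
  have := component_nbr_cut cF (subsetIr A F) AF0.
  have := subset_leq_card (subsetIr A F).
  have : nbr (fun y x => e x y) (A :&: F) :&: S \subset
         nbr (fun y x => e x y) A :&: S.
    by rewrite -{2}(setUidPl (subsetIl A F)) nbrU setSI // subsetUr.
  move/subset_leq_card; move: leFF' ltAF'; clear; lia.
have [||A AS|A AY|h hout [Yh Ph]] := @matching_out_covering P (X :\: P).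
- exact: subset_trans XS.
- exact: setSD.
(* Two vertices are lost in [P]. One is made up for by [E], the other by the neighbours of [A] in
   both [C] and [D]; if [A] is larger than both, [card_rest] suffices. *)
- have [->|A0] := eqVneq A set0; first by rewrite cards0.
  rewrite -card_gt0 in A0.
  have := cut_nbr_component cC AS; have := cut_nbr_component cD AS.
  have := subset_leq_card AS; have [//|] := cut_nbr_avoid hX XS PX leP AS.
  have -> : #|nbr e A :&: X| = #|nbr e A :&: C| + #|nbr e A :&: D|.
    by rewrite setIUr cardsU setIACA setIid dCD setI0 cards0 subn0.
  rewrite S_card; lia.
- have AX : A = (A :&: C) :|: (A :&: D).
    by rewrite -setIUr; apply/esym/setIidPl; apply: subset_trans AY (subsetDl _ _).
  have cardA : #|A| = #|A :&: C| + #|A :&: D|.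
    by rewrite {1}AX cardsU setIACA setIid dCD setI0 cards0 subn0.
  have ltA (F : {set T}) z : z \in F -> z \in P -> #|A :&: F| < #|F|.
    move=> zF zP; apply: proper_card; apply/properP; split; first exact: subsetIr.
    exists z => //; rewrite in_setI negb_and; apply/orP; left.
    by apply/negP => /(subsetP AY); rewrite in_setD zP.
  have ltAC := ltA C x xC (set21 _ _); have ltAD := ltA D y yD (set22 _ _).
  have [AC0|AC0] := eqVneq (A :&: C) set0; last by rewrite cardA leN.
  have [AD0|AD0] := eqVneq (A :&: D) set0; first by rewrite cardA AC0 AD0 cards0.
  by rewrite cardA addnC leN // addnC.
have rest z F : comp F -> F \subset X -> z \in F -> z \in P ->
    (forall t, t \in F -> t \in P -> t = z) -> #|F :\: h @: S| = 1.
  move=> cF FX zF zP uz; apply/eqP/cards1P; exists z; apply/setP => t.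
  rewrite in_setD in_set1; apply/andP/eqP => [[th tF]|->].
    apply: uz => //; apply: contraNT th => tP; apply: (subsetP Yh).
    by rewrite inE tP (subsetP FX).
  by split=> //; have /pred0P/(_ z) := Ph; rewrite /= zP /= => ->.
have := not_two_odd_components_out hout cC cD nCD.
rewrite (rest x C cC (subsetUl _ _) xC (set21 _ _)); last first.
  move=> t tC /set2P[//|tE]; have := comp_disj cC cD nCD tC.
  by rewrite tE yD.
rewrite (rest y D cD (subsetUr _ _) yD (set22 _ _)) //.
move=> t tD /set2P[tE|//]; have := comp_disj cC cD nCD xC.
by rewrite -tE tD.
Qed.

(** * Moving partners of cut vertices between components *)

Lemma imset_out_setD h E J : matching_out h -> J \subset S ->
  E :\: h @: (S :\: J) = (E :\: h @: S) :|: (E :&: h @: J).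
Proof.
move=> [h_inj _] /subsetP JS; apply/setP => z.
rewrite in_setU in_setI !in_setD; case: (z \in E); rewrite ?andbF ?andbT //=.
apply/idP/orP => [nS|].
  have [zJ|zJ] := boolP (z \in h @: J); [by right|left].
  apply: contra nS => /imsetP[s sS zE]; apply/imsetP; exists s => //.
  by rewrite inE sS andbT; apply: contra zJ => sJ; rewrite zE imset_f.
case=> [nS|/imsetP[j jJ ->]]; apply/imsetP => -[s /setDP[sS sJ] zE].
  by rewrite zE imset_f in nS.
by rewrite -(h_inj _ _ (JS _ jJ) sS zE) jJ in sJ.
Qed.

Lemma rematch h D J : matching_out h -> comp D -> [disjoint h @: S & D] ->
    J \subset S -> #|J| <= #|D| ->
  exists h' : T -> T, [/\ matching_out h', #|D :\: h' @: S| + #|J| = #|D| &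
    forall E, [disjoint E & D] ->
      E :\: h' @: S = (E :\: h @: S) :|: (E :&: h @: J)].
Proof.
move=> hout cD /pred0P dhD JS leJD; have [h_inj hP] := hout.
have [s0 s0S] : exists s, s \in S by apply/card_gt0P; rewrite S_card; lia.
have hD s : s \in S -> h s \in D = false.
  by move=> sS; have := dhD (h s); rewrite /= imset_f.
have [|g [g_inj gP]] := @hall _ _ s0 (fun x y => e x y && (y \in D)) J.
  move=> A AJ; have AS := subset_trans AJ JS.
  have := cut_nbr_component cD AS.
  rewrite (minn_idPl (leq_trans (subset_leq_card AJ) leJD)) => /leq_trans; apply.
  apply/subset_leq_card/subsetP => y /setIP[/nbrP[x xA exy] yD].
  by apply/nbrP; exists x; rewrite // exy.
have gD j : j \in J -> g j \in D by move/gP/andP => [].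
pose h' s := if s \in J then g s else h s.
have h'J : h' @: J = g @: J by apply: eq_in_imset => j; rewrite /h' => ->.
have h'SJ : h' @: (S :\: J) = h @: (S :\: J).
  by apply: eq_in_imset => j /setDP[_ /negbTE]; rewrite /h' => ->.
have h'out : matching_out h'.
  split=> [s t sS tS|s sS]; rewrite /h'.
    case: ifP => sJ; case: ifP => tJ; [exact: g_inj| | |exact: h_inj] => E.
      by have := hD t tS; rewrite -E gD.
    by have := hD s sS; rewrite E gD.
  case: ifP => sJ; last exact: hP.
  by have /andP[-> /(compS cD) ->] := gP _ sJ.
have SE : h' @: S = g @: J :|: h @: (S :\: J).
  by rewrite -{1}(setID S J) (setIidPr JS) imsetU h'J h'SJ.
exists h'; split=> // [|E /pred0P dED].
  have -> : D :\: h' @: S = D :\: g @: J.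
    apply/setP => z; rewrite !in_setD SE in_setU negb_or.
    have [zD|] := boolP (z \in D); rewrite ?andbF // !andbT andbC.
    suff -> : z \notin h @: (S :\: J) by [].
    by apply/negP => /imsetP[s /setDP[sS _] zE]; rewrite zE hD in zD.
  have gJD : g @: J \subset D by apply/subsetP => _ /imsetP[j /gD ? ->].
  by rewrite -(card_in_imset g_inj) -(cardsID (g @: J) D) (setIidPr gJD) addnC.
rewrite -imset_out_setD // SE; apply/setP => z; rewrite !in_setD in_setU negb_or.
have [zE|] := boolP (z \in E); rewrite ?andbF // !andbT.
suff -> : z \notin g @: J by [].
apply/negP => /imsetP[j /gD gjD zj].
by have := dED z; rewrite /= zE zj gjD.
Qed.

(** Match [S] into [C] and move one to three, or no, partners to [D]: the resulting even rests are
    the sets required in [randomly_matchable_complete]. *)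
Lemma large_component_complete C D : comp C -> comp D -> C != D ->
  k <= #|C| -> 3 <= #|D| -> complete e C.
Proof.
move=> cC cD nCD leC leD; have CS := component_sub e_sym cC.
have [A AS|f fout fC] := matching_out_into CS.
  have leA : #|A| <= #|C| by rewrite (leq_trans _ leC) // -S_card subset_leq_card.
  by have := cut_nbr_component cC AS; rewrite (minn_idPl leA).
have [f_inj fP] := fout; pose c := odd (#|C| - k).
have fD : [disjoint f @: S & D].
  by apply: disjointWl fC _; apply: comp_disjoint.
have rand J : J \subset S -> #|J| <= 3 -> odd #|J| = c ->
    randomly_matchable e (C :\: f @: S :|: f @: J).
  move=> JS leJ oJ V VR pV.
  have [h' [h'out _ /(_ C)]] := rematch fout cD fD JS (leq_trans leJ leD).
  rewrite comp_disjoint // => /(_ isT) CE.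
  have fJC : C :&: f @: J = f @: J.
    by apply/setIidPr/(subset_trans _ fC)/imsetS.
  rewrite fJC in CE; rewrite -CE in VR *.
  apply: pm_component_out => //; rewrite CE.
  rewrite cardsU setIDAC cardsD (setIidPr fC) (card_in_imset f_inj) S_card.
  have fJ_inj : {in J &, injective f}.
    by move=> s t sJ tJ; apply: f_inj; apply: (subsetP JS).
  rewrite (card_in_imset fJ_inj).
  have -> : C :&: f @: J :\: f @: S = set0.
    by apply/eqP; rewrite fJC setD_eq0 imsetS.
  by rewrite cards0 subn0 oddD oJ addbb.
apply: (@randomly_matchable_complete _ e (~: S) C S f c) => //.
- by rewrite S_card.
(* The moved set [J] is [[set l]] or empty here, and gains [i] and [j] in the next case; its parity
   is [c] throughout. *)
- move=> l lS; have := rand (if c then [set l] else set0).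
  case cE: c; rewrite ?imset_set1 ?imset0 ?setU0 ?cards1 ?cards0.
    by rewrite setUC; apply; rewrite ?sub1set.
  by apply; rewrite ?sub0set.
- move=> i j l iS jS lS ij li lj.
  have ijS : [set i; j] \subset S by apply/subsetP => z /set2P[] ->.
  have lij : l \notin [set i; j] by rewrite !inE negb_or li lj.
  have := rand (if c then l |: [set i; j] else [set i; j]).
  case cE: c; rewrite !imsetU1 imset_set1.
    rewrite cardsU1 lij cards2 ij => r; rewrite -setUA setUCA.
    by apply: r => //; rewrite subUset sub1set lS.
  by rewrite cards2 ij; apply.
Qed.

(** Redirecting [s], [t] or both into [C] flips the parities of the rests of [C] and [E], of [C] and
    [F], or of [E] and [F]. From any initial parities, one of the four matchings has two odd
    rests. *)
Lemma two_odd_swaps h C E F s t : matching_out h -> comp C -> comp E -> comp F ->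
    C != E -> C != F -> E != F -> 1 < #|C| -> [disjoint h @: S & C] ->
    s \in S -> t \in S -> h s \in E -> h t \in F -> False.
Proof.
move=> hout cC cE cF nCE nCF nEF gtC dhC sS tS hsE htF.
have [h_inj hP] := hout.
have hsF : h s \notin F by apply: comp_disj hsE.
have htE : h t \notin E by apply: comp_disj htF; rewrite 1?eq_sym.
have nst : s != t by apply: contraNneq hsF => ->.
have swap J : J \subset S -> #|J| <= 2 -> exists h' : T -> T,
    [/\ matching_out h', #|C :\: h' @: S| + #|J| = #|C|,
      #|E :\: h' @: S| = #|E :\: h @: S| + #|E :&: h @: J| &
      #|F :\: h' @: S| = #|F :\: h @: S| + #|F :&: h @: J|].
  move=> JS leJ; have [h' [h'out CE h'E]] := rematch hout cC dhC JS (leq_trans leJ gtC).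
  have card G : comp G -> C != G ->
      #|G :\: h' @: S| = #|G :\: h @: S| + #|G :&: h @: J|.
    move=> cG nCG; rewrite h'E; last by rewrite comp_disjoint // eq_sym.
    rewrite cardsU setIDAC.
    have -> : G :&: (G :&: h @: J) :\: h @: S = set0.
      by apply/eqP; rewrite setIA setD_eq0 (subset_trans (subsetIr _ _)) // imsetS.
    by rewrite cards0 subn0.
  by exists h'; split=> //; apply: card.
have in1 (G : {set T}) x : #|G :&: [set x]| = (x \in G).
  case: (boolP (x \in G)) => xG; first by rewrite (setIidPr _) ?cards1 ?sub1set.
  by apply/eqP; rewrite cards_eq0 setI_eq0 disjoint_sym disjoints1.
have c0 : #|C :\: h @: S| = #|C|.
  by congr #|pred_of_set _|; apply/setDidPl; rewrite disjoint_sym.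
have [h1 [h1out C1 E1 _]] := swap [set s] ltac:(by rewrite sub1set) ltac:(by rewrite cards1).
have [h2 [h2out C2 _ F2]] := swap [set t] ltac:(by rewrite sub1set) ltac:(by rewrite cards1).
have stS : [set s; t] \subset S by apply/subsetP => z /set2P[] ->.
have [h3 [h3out _ E3 F3]] := swap _ stS ltac:(by rewrite cards2 nst).
have := not_two_odd_components_out h3out cE cF nEF.
have := not_two_odd_components_out h2out cC cF nCF.
have := not_two_odd_components_out h1out cC cE nCE.
have := not_two_odd_components_out hout cC cE nCE.
have := not_two_odd_components_out hout cC cF nCF.
have := not_two_odd_components_out hout cE cF nEF.
have Est : E :&: [set h s; h t] = [set h s].
  by rewrite setIUr (setIidPr _) ?sub1set // disjoint_setI0 ?setU0 // disjoint_sym disjoints1.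
have Fst : F :&: [set h s; h t] = [set h t].
  rewrite setIUr (setIidPr (_ : [set h t] \subset F)) ?sub1set //.
  by rewrite disjoint_setI0 ?set0U // disjoint_sym disjoints1.
have odd_pred n m : n + 1 = m -> odd n = ~~ odd m by move=> <-; rewrite addn1 /= negbK.
move: C1 E1 C2 F2 E3 F3; rewrite imsetU1 !imset_set1 !cards1 Est Fst !cards1.
rewrite !in1 hsE htF => /odd_pred-> -> /odd_pred-> -> -> ->.
rewrite !addn1 /= c0.
by case: (odd #|C|); case: (odd #|E :\: _|); case: (odd #|F :\: _|).
Qed.

Lemma matching_out_update h s v : matching_out h -> s \in S -> e s v ->
  v \notin S -> v \notin h @: S ->
  matching_out (fun x => if x == s then v else h x).
Proof.
move=> [h_inj hP] sS esv vS vh; have hv t : t \in S -> (h t == v) = false.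
  by move=> tS; apply: contraNF vh => /eqP <-; apply: imset_f.
split=> [x y xS yS|x xS]; last by case: eqVneq => [->|_] //; apply: hP.
case: eqVneq => [->|xs]; case: eqVneq => [->|ys] //; last exact: h_inj.
  by move/esym/eqP; rewrite hv.
by move/eqP; rewrite hv.
Qed.

(** Match [S] outside [C] with partners in two different components, then apply [two_odd_swaps]. *)
Lemma three_components C E F : comp C -> comp E -> comp F ->
  C != E -> C != F -> E != F -> 1 < #|C| -> False.
Proof.
move=> cC cE cF nCE nCF nEF gtC.
have gtEF : k + 1 < #|E| + #|F| by apply: (two_small_components cE cF cC).
have dEF : E :&: F = set0 by apply/eqP; rewrite setI_eq0 comp_disjoint.
have EFS : E :|: F \subset ~: S :\: C.
  apply/subsetP => z /setUP[] zG; rewrite !inE.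
    by rewrite (comp_disj cE cC _ zG) 1?eq_sym // (compS cE zG).
  by rewrite (comp_disj cF cC _ zG) 1?eq_sym // (compS cF zG).
(* The components [E] and [F] together leave enough room to match all of [S] outside [C]. *)
have leSC : k <= #|~: S :\: C|.
  have := subset_leq_card EFS; rewrite cardsU dEF cards0 subn0.
  by apply: leq_trans; apply: ltnW; rewrite -addn1; apply: ltnW.
have hC G : comp G -> G \subset C \/ [disjoint G & C].
  move=> cG; have [->|nGC] := eqVneq G C; first by left.
  by right; apply: comp_disjoint.
have [A AS|h hout hSC] := matching_out_into (subsetDl (~: S) C).
  have [//|sA] := cut_nbr_rest hC AS; rewrite (setIidPr sA).
  by apply: leq_trans (subset_leq_card AS) _; rewrite S_card.
have avoidC h' : h' @: S \subset ~: S :\: C -> [disjoint h' @: S & C].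
  by move=> h'SC; rewrite disjoints_subset; apply: subset_trans h'SC _; rewrite setDE subsetIr.
have compP x : x \in S -> exists2 G, comp G & h x \in G /\ C != G.
  move=> xS; have : h x \in ~: S :\: C by apply: (subsetP hSC); apply: imset_f.
  rewrite inE => /andP[xC xNS].
  have /bigcupP[G cG xG] : h x \in cover (components e (~: S)).
    by rewrite (cover_partition (components_partition e_sym (~: S))).
  exists G => //; split=> //.
  by apply: contraNneq xC => ->.
have [s sS] : exists s, s \in S by apply/card_gt0P; rewrite S_card; lia.
have [t] : exists t, t \in S :\ s.
  by apply/card_gt0P; have := cardsD1 s S; rewrite sS S_card; lia.
rewrite !inE => /andP[nts tS].
have [G cG [sG nCG]] := compP s sS; have [H cH [tH nCH]] := compP t tS.
have [GH|nGH] := eqVneq G H; last first.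
  exact: (two_odd_swaps hout cC cG cH nCG nCH nGH gtC (avoidC _ hSC) sS tS sG tH).
(* Both partners lie in [H], so a neighbour [v] of [s] in a third component [I] is used: either [v]
   is already a partner, or [s] is redirected to it. *)
have [I cI [nCI nIH]] : exists2 I, comp I & C != I /\ I != H.
  have [EH|nEH] := eqVneq E H; last by exists E.
  by exists F; rewrite // -EH (eq_sym F) nCF.
have [v] : exists v, v \in nbr e [set s] :&: I.
  apply/card_gt0P; apply: leq_trans (cut_nbr_component cI _); last by rewrite sub1set.
  by rewrite cards1 leq_min (component_gt0 e_sym cI).
rewrite inE => /andP[/nbrP[_ /set1P -> esv] vI].
have [/imsetP[r rS vr]|vh] := boolP (v \in h @: S).
  rewrite vr in vI.
  exact: (two_odd_swaps hout cC cI cH nCI nCH nIH gtC (avoidC _ hSC) rS tS vI tH).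
have hout' := matching_out_update hout sS esv (compS cI vI) vh.
set h' := fun x => _ in hout'.
have h'SC : h' @: S \subset ~: S :\: C.
  apply/subsetP => _ /imsetP[x xS ->]; rewrite /h'; case: eqP => _.
    by rewrite !inE (compS cI vI) (comp_disj cI cC _ vI) // eq_sym.
  by apply: (subsetP hSC); apply: imset_f.
apply: (two_odd_swaps hout' cC cI cH nCI nCH nIH gtC (avoidC _ h'SC) sS tS).
  by rewrite /h' eqxx.
by rewrite /h' (negbTE nts).
Qed.

End EquimatchableCut.

Theorem theorem11 (k : nat) (hk : 3 <= k)
    (T : finType) (e : rel T) (e_sym : symmetric e) (e_irr : irreflexive e)
    (G_conn : k_connected e k) (G_eqm : equimatchable e)
    (G_fc : factor_critical e) (G_card : 2 * k + 3 <= #|T|)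
    (S : {set T}) (S_cut : vertex_cut e S) (S_card : #|S| = k)
    (S_comp : exists C1 C2 : {set T},
       [/\ C1 \in components e (~: S), C2 \in components e (~: S), C1 != C2,
           3 <= #|C1| & 3 <= #|C2|]) :
  #|components e (~: S)| = 2 /\
  (forall C : {set T}, C \in components e (~: S) -> complete e C).
Proof.
case: S_comp => C1 [C2 [cC1 cC2 nC12 le1 le2]].
have card2 : #|components e (~: S)| = 2.
  apply/eqP; rewrite eqn_leq (S_cut : 1 < _) andbT leqNgt; apply/negP => gt2.
  have /card_gt0P[C3] : 0 < #|components e (~: S) :\ C1 :\ C2|.
    have := cardsD1 C1 (components e (~: S)); rewrite cC1.
    have := cardsD1 C2 (components e (~: S) :\ C1).
    rewrite in_setD1 (eq_sym C2) nC12 cC2 => -> E; rewrite E in gt2.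
    by move: gt2; rewrite !add1n !ltnS.
  rewrite !inE => /and3P[n32 n31 cC3].
  apply: (three_components e_sym e_irr G_eqm G_fc G_conn S_card S_cut hk G_card
           cC1 cC2 cC3); rewrite // 1?eq_sym //.
  by rewrite (leq_trans _ le1).
split=> // C cC.
(* One of [C1] and [C2] differs from [C]; it provides the three vertices outside [C] that both
   completeness lemmas require. *)
have [D cD [nCD leD]] : exists2 D : {set T}, D \in components e (~: S) &
    C != D /\ 3 <= #|D|.
  have [->|nC1] := eqVneq C C1; first by exists C2.
  by exists C1.
have [leC|ltC] := leqP #|C| k; last first.
  exact: (large_component_complete e_sym e_irr G_eqm G_fc G_conn S_card S_cut
    hk G_card cC cD nCD (ltnW ltC) leD).
apply: (small_component_complete e_sym e_irr G_eqm G_fc G_conn S_card S_cut hk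
  G_card cC leC).
apply: leq_trans leD _; rewrite subset_leq_card // subsetD.
by rewrite (component_sub e_sym cD) disjoint_sym (component_disjoint e_sym cC cD).
Qed.
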